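(* For every positive integer $\ell$, every $P_5$-free graph that has no induced subgraph isomorphic to $K_{\ell,\ell}$ has tree-independence number at most $4\ell$.
   Context: All graphs are finite, simple and undirected. $P_5$ is the path on $5$ vertices; a graph is $H$-free if it has no induced subgraph isomorphic to $H$. $K_{\ell,\ell}$ is the complete bipartite graph with both parts of size $\ell$. A tree-decomposition of a graph $G$ is a pair $(T,\{B_t\}_{t\in V(T)})$ where $T$ is a tree and each $B_t\subseteq V(G)$, such that for every vertex $v$ the set of nodes $t$ with $v\in B_t$ is nonempty and induces a connected subtree of $T$, and for every edge $uv$ some bag contains both $u$ and $v$. Its independence number is $\max_t \alpha(G[B_t])$, where $\alpha$ denotes the maximum size of an independent set. The tree-independence number of $G$ is the minimum independence number over all tree-decompositions of $G$. *)

(* Defs.v *)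
From mathcomp Require Import all_boot.
From mathcomp Require Import boolp.

Set Implicit Arguments.
Unset Strict Implicit.
Unset Printing Implicit Defensive.

Record sgraph := SGraph {
  vertex :> finType;
  adj : rel vertex;
  adj_sym : symmetric adj;
  adj_irrefl : irreflexive adj }.

Definition isomorphic (G H : sgraph) : Prop :=
  exists2 f : G -> H, bijective f & forall x y : G, adj (f x) (f y) = adj x y.

Section Induced.
Variables (G : sgraph) (S : {set G}).

Definition induced_adj : rel {x : G | x \in S} :=
  fun x y => adj (val x) (val y).

Lemma induced_adj_sym : symmetric induced_adj.
Proof. by move=> x y; apply: adj_sym. Qed.

Lemma induced_adj_irrefl : irreflexive induced_adj.
Proof. by move=> x; apply: adj_irrefl. Qed.

Definition induced : sgraph := SGraph induced_adj_sym induced_adj_irrefl.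
End Induced.

Definition free (H G : sgraph) : Prop :=
  ~ exists S : {set G}, isomorphic (induced S) H.

Section PathGraph.
Variable n : nat.

Definition path_adj : rel 'I_n := fun i j => (i.+1 == j) || (j.+1 == i).

Lemma path_adj_sym : symmetric path_adj.
Proof. by move=> i j; rewrite /path_adj orbC. Qed.

Lemma path_adj_irrefl : irreflexive path_adj.
Proof. by move=> i; rewrite /path_adj orbb gtn_eqF. Qed.

Definition path_graph : sgraph := SGraph path_adj_sym path_adj_irrefl.
End PathGraph.

Section CompleteBipartite.
Variables m n : nat.

Definition bipartite_adj : rel ('I_m + 'I_n)%type := fun x y =>
  match x, y with
  | inl _, inr _ | inr _, inl _ => true
  | _, _ => false
  end.

Lemma bipartite_adj_sym : symmetric bipartite_adj.
Proof. by case=> ? []. Qed.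

Lemma bipartite_adj_irrefl : irreflexive bipartite_adj.
Proof. by case. Qed.

Definition complete_bipartite : sgraph :=
  SGraph bipartite_adj_sym bipartite_adj_irrefl.
End CompleteBipartite.

Definition independent (G : sgraph) (S : {set G}) : bool :=
  [forall x in S, forall y in S, ~~ adj x y].

Definition alpha (G : sgraph) : nat :=
  \max_(S : {set G} | independent S) #|S|.

Definition connected (G : sgraph) : Prop :=
  forall x y : G, connect (@adj G) x y.

(* [ucycle] also holds of the empty sequence and of [:: x; y] for any edge xy;
   the cycles of a graph are those with at least three vertices. *)
Definition acyclic (G : sgraph) : Prop :=
  forall c : seq G, 2 < size c -> ~ ucycle (@adj G) c.

Definition is_tree (T : sgraph) : Prop :=
  [/\ 0 < #|T|, connected T & acyclic T].

Record tree_decomposition (G : sgraph) := TreeDecomposition {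
  td_tree : sgraph;
  td_treeP : is_tree td_tree;
  bag : td_tree -> {set G};
  bag_cover : forall v : G, exists t, v \in bag t;
  bag_connected : forall v : G, connected (induced [set t | v \in bag t]);
  bag_edge : forall u v : G, adj u v -> exists t, (u \in bag t) && (v \in bag t) }.

Definition td_alpha (G : sgraph) (D : tree_decomposition G) : nat :=
  \max_(t : td_tree D) alpha (induced (bag t)).

(* The decomposition with a single bag V(G) shows that the minimum defining the
   tree-independence number is over a nonempty set. *)
Lemma trivial_tree_decomposition (G : sgraph) : tree_decomposition G.
Proof.
have conn1 (x y : 'I_1) : x = y by rewrite !ord1.
apply: (@TreeDecomposition G (path_graph 1) _ (fun=> [set: G])).
- split; first by rewrite card_ord.
  + by move=> x y; rewrite (conn1 x y).
  + move=> c c_gt2 /andP[_ /card_uniqP c_uniq].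
    by have := max_card (mem c); rewrite c_uniq card_ord leqNgt ltnW.
- by move=> v; exists ord0; rewrite inE.
- by move=> v x y; rewrite (val_inj (conn1 (val x) (val y))).
- by move=> u v _; exists ord0; rewrite !inE.
Qed.

Lemma td_alpha_ex (G : sgraph) :
  exists n, `[< exists D : tree_decomposition G, td_alpha D = n >].
Proof.
by exists (td_alpha (trivial_tree_decomposition G)); apply/asboolP; eexists.
Qed.

Definition tree_alpha (G : sgraph) : nat := ex_minn (td_alpha_ex G).

(* Main.v *)
Require Import Defs.
From mathcomp Require Import all_boot.
From mathcomp Require boolp.

(* Let [I] be a maximum independent set of [G]. An independent set inside the
   neighbourhood of some [r] in [I] has at most [2 * l] vertices: its traces on
   [I] are nested because [G] is P5-free, so K_{l,l} bounds the number of large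
   traces and the maximality of [I] bounds the number of small ones.
   Among the chordal completions of [G] that add no edge at a vertex of [I] but
   make each of its neighbourhoods a clique, take one with as few edges as
   possible, and let [S] be a maximal clique of it. If [S] meets [I], then [S]
   lies in a closed neighbourhood. Otherwise, by minimality, any two nonadjacent
   vertices of [S] are both attached to some component of [G - S], and no
   component is attached to all of [S]. If [J] is an independent subset of [S],
   P5-freeness yields one component [D] attached to all of [J], and shows that
   the vertices of [I] inside [D] have nested traces on [J] (a P5 would run
   outside [D]), as do those outside [D] (a P5 would run through [D]). Hence
   [J] is covered by the neighbourhoods of two vertices of [I], and has at most
   [4 * l] vertices. *)

Set Implicit Arguments.
Unset Strict Implicit.
Unset Printing Implicit Defensive.

(** * Induced paths and bicliques *)

Lemma embedding_not_free (H G : sgraph) (f : H -> G) :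
  injective f -> (forall x y, adj (f x) (f y) = adj x y) -> ~ free H G.
Proof.
move=> f_inj f_adj; apply; exists [set f x | x in H].
have fS x : f x \in [set f x | x in H] by apply: imset_f.
pose g x : {y | y \in [set f x | x in H]} := Sub (f x) (fS x).
have g_bij : bijective g.
  apply: inj_card_bij => [x y /(congr1 val) /f_inj //|].
  by rewrite card_sig -(card_imset H f_inj) leq_eqVlt; apply/orP; left; apply/eqP/eq_card.
have [h gK hK] := g_bij.
exists h => [|x y]; first by exists g.
by rewrite -f_adj -[x in RHS]hK -[y in RHS]hK.
Qed.

Lemma path_P5 (G : sgraph) (a b c d e : G) :
  adj a b -> adj b c -> adj c d -> adj d e ->
  ~~ adj a c -> ~~ adj a d -> ~~ adj a e -> ~~ adj b d -> ~~ adj b e ->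
  ~~ adj c e -> ~ free (path_graph 5) G.
Proof.
move=> ab bc cd de /negPf nac /negPf nad /negPf nae /negPf nbd /negPf nbe /negPf nce.
pose f (i : path_graph 5) := nth a [:: a; b; c; d; e] (i : 'I_5).
have f_adj i j : adj (f i) (f j) = adj i j.
  case: i => -[|[|[|[|[|i]]]]] // lti; case: j => -[|[|[|[|[|j]]]]] // ltj;
    by rewrite /f /= ?adj_irrefl // /adj /= /path_adj /= -/(adj _ _);
       rewrite ?(ab, bc, cd, de, nac, nad, nae, nbd, nbe, nce) // adj_sym
         ?(ab, bc, cd, de, nac, nad, nae, nbd, nbe, nce).
apply: (embedding_not_free _ f_adj) => i j fij; apply/eqP.
(* Distinct vertices of P5 have distinct neighbourhoods, so preserving adjacency and nonadjacency
   forces injectivity. *)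
have eqN k : adj i k = adj j k by rewrite -!f_adj fij.
move: (eqN ord0) (eqN (inord 1)) (eqN (inord 2)) (eqN (inord 3)) (eqN (inord 4)).
rewrite /adj /= /path_adj /= !inordK // -val_eqE /=.
by case: i {fij eqN} => -[|[|[|[|[|i]]]]] // lti; case: j => -[|[|[|[|[|j]]]]] // ltj.
Qed.

Lemma biclique_not_free (G : sgraph) (l : nat) (A B : {set G}) :
  independent A -> independent B -> l <= #|A| -> l <= #|B| ->
  (forall x y, x \in A -> y \in B -> adj x y) ->
  ~ free (complete_bipartite l l) G.
Proof.
move=> indA indB lA lB AB.
have wid (X : {set G}) : l <= #|X| -> {f : 'I_l -> G | injective f & forall i, f i \in X}.
  move=> lX; exists (fun i => enum_val (widen_ord lX i)) => [i j|i]; last exact: enum_valP.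
  by move=> /enum_val_inj [/val_inj].
have [f f_inj fA] := wid _ lA; have [g g_inj gB] := wid _ lB.
have indP (X : {set G}) x y : independent X -> x \in X -> y \in X -> adj x y = false.
  by move=> /forall_inP X0 xX yX; apply/negbTE; move/forall_inP: (X0 x xX); apply.
pose h (u : complete_bipartite l l) := match u with inl i => f i | inr j => g j end.
have h_adj u v : adj (h u) (h v) = adj u v.
  case: u v => [i|i] [j|j] /=; rewrite ?[RHS]/adj /=.
  - exact: (indP A).
  - exact: AB.
  - by rewrite adj_sym; apply: AB.
  - exact: (indP B).
apply: (embedding_not_free _ h_adj) => -[i|i] [j|j] /=.
- by move/f_inj->.
- by move=> e; have := AB _ _ (fA i) (gB j); rewrite e adj_irrefl.
- by move=> e; have := AB _ _ (fA j) (gB i); rewrite e adj_irrefl.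
- by move/g_inj->.
Qed.

(** Adjacency of [G[Y]], kept as a relation on all of [G]; [connect (restr Y) x x] therefore holds
    even for [x] outside [Y]. *)
Definition restr (G : sgraph) (Y : {set G}) : rel G :=
  fun x y => [&& adj x y, x \in Y & y \in Y].

Lemma restr_sym (G : sgraph) (Y : {set G}) : symmetric (restr Y).
Proof. by move=> x y; rewrite /restr adj_sym [(y \in Y) && _]andbC. Qed.

Lemma restr_connect_sub (G : sgraph) (Y Z : {set G}) x y :
  Y \subset Z -> connect (restr Y) x y -> connect (restr Z) x y.
Proof.
move/subsetP=> YZ; apply: connect_sub => u v /and3P[uv /YZ uZ /YZ vZ].
by apply: connect1; rewrite /restr uv uZ vZ.
Qed.

(** The hypotheses put [x] and [y] at distance at least 4 in [G[Y]], so a shortest path between them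
    starts with an induced P5. In the induction on the length, a chord among the first five vertices
    yields a shorter walk. *)
Lemma far_not_P5_free (G : sgraph) (Y : {set G}) x y :
  connect (restr Y) x y -> x != y -> ~~ adj x y ->
  (forall a, a \in Y -> adj x a -> ~~ adj a y) ->
  (forall a b, a \in Y -> b \in Y -> adj x a -> adj a b -> ~~ adj b y) ->
  ~ free (path_graph 5) G.
Proof.
move=> /connectP[p] xp ->{y}; have [n] := ubnP (size p).
elim: n p xp => // n IHn p xp; rewrite ltnS => pn nexy nxy nxay nxaby freeG.
have shorter q : path (restr Y) x q -> last x q = last x p -> size q < size p -> False.
  by move=> xq eq_last ltq; apply: (IHn q) => //; rewrite ?eq_last // (leq_trans ltq).
case: p xp pn nexy nxy nxay nxaby shorter => [|x1 [|x2 [|x3 [|x4 p]]]] /=; rewrite ?eqxx //.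
- by move=> /andP[/and3P[-> ]].
- by move=> /and3P[/and3P[a1 _ x1Y] /and3P[a2 _ _] _] _ _ _ /(_ x1 x1Y a1); rewrite a2.
- move=> /and4P[/and3P[a1 _ x1Y] /and3P[a2 _ x2Y] /and3P[a3 _ _] _] _ _ _ _.
  by move=> /(_ x1 x2 x1Y x2Y a1 a2); rewrite a3.
move=> /and5P[/and3P[a1 xY x1Y] r2 r3 r4 r5] _ _ _ _ _ shorter.
have [/and3P[a2 _ x2Y] /and3P[a3 _ x3Y] /and3P[a4 _ x4Y]] := And3 r2 r3 r4.
apply: (path_P5 a1 a2 a3 a4) freeG; apply/negP => ch.
- by apply: (shorter [:: x2, x3, x4 & p]); rewrite //= r3 r4 r5 /restr ch xY x2Y.
- by apply: (shorter [:: x3, x4 & p]); rewrite /= ?r4 ?r5 /restr ?ch ?xY ?x3Y ?ltnS ?leqW.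
- by apply: (shorter [:: x4 & p]); rewrite /= ?r4 ?r5 /restr ?ch ?xY ?x4Y ?ltnS ?leqW.
- by apply: (shorter [:: x1, x3, x4 & p]); rewrite /= ?r4 ?r5 /restr ?ch ?a1 ?xY ?x1Y ?x3Y ?ltnS ?leqW.
- by apply: (shorter [:: x1, x4 & p]); rewrite /= ?r4 ?r5 /restr ?ch ?a1 ?xY ?x1Y ?x4Y ?ltnS ?leqW.
- by apply: (shorter [:: x1, x2, x4 & p]); rewrite /= ?r4 ?r5 /restr ?ch ?a1 ?a2 ?xY ?x1Y ?x2Y ?x4Y ?ltnS ?leqW.
Qed.

(* The only exits from [r] and [r'] are [j] and [j'], so [r] and [r'] are at
   distance at least 4. *)
Lemma pendants_not_P5_free (G : sgraph) (Q : {set G}) r j j' r' :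
  adj r j -> adj j' r' -> ~~ adj r j' -> ~~ adj j r' -> ~~ adj r r' -> ~~ adj j j' ->
  (forall x, x \in Q -> ~~ adj r x /\ ~~ adj x r') ->
  connect (restr (j |: (j' |: Q))) j j' -> ~ free (path_graph 5) G.
Proof.
move=> rj jr rj' jr' rr' jj' rQ con.
pose Y := [set r; r'] :|: (j |: (j' |: Q)).
have rY x : x \in Y -> adj r x -> x = j.
  rewrite !inE => /orP[/orP[]/eqP->|/or3P[/eqP->|/eqP->|/rQ[/negPf->]]] //.
  - by rewrite adj_irrefl.
  - by rewrite (negPf rr').
  - by rewrite (negPf rj').
have r'Y x : x \in Y -> adj x r' -> x = j'.
  rewrite !inE => /orP[/orP[]/eqP->|/or3P[/eqP->|/eqP->|/rQ[_ /negPf->]]] //.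
  - by rewrite (negPf rr').
  - by rewrite adj_irrefl.
  - by rewrite (negPf jr').
apply: (@far_not_P5_free _ Y r r') => //.
- apply: (@connect_trans _ _ j); first by apply: connect1; rewrite /restr rj !inE !eqxx ?orbT.
  apply: (@connect_trans _ _ j'); last first.
    by apply: connect1; rewrite /restr jr !inE !eqxx ?orbT.
  by apply: restr_connect_sub con; rewrite subsetUr.
- by apply: contraNneq rj' => ->; rewrite adj_sym.
- by move=> a aY /(rY _ aY) ->.
- move=> a b aY bY /(rY _ aY) -> jb; apply/negP => /(r'Y _ bY) eb.
  by rewrite -eb jb in jj'.
Qed.

(** * Neighbourhoods of vertices of a maximum independent set *)

Lemma independentP (G : sgraph) (S : {set G}) :
  reflect {in S &, forall x y, ~~ adj x y} (independent S).
Proof.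
apply: (iffP forall_inP) => [S0 x y xS yS|S0 x xS].
  by move/forall_inP: (S0 x xS); apply.
by apply/forall_inP => y yS; apply: S0.
Qed.

Lemma independentS (G : sgraph) (S T : {set G}) :
  S \subset T -> independent T -> independent S.
Proof.
move=> /subsetP ST /independentP T0; apply/independentP => x y /ST xT /ST yT.
exact: T0.
Qed.

Definition nbhd (G : sgraph) (x : G) : {set G} := [set y | adj x y].

Lemma in_nbhd (G : sgraph) (x y : G) : (y \in nbhd x) = adj x y.
Proof. by rewrite inE. Qed.

Lemma nested_max (T U : finType) (R : {set T}) (f : T -> {set U}) x0 :
  x0 \in R -> {in R &, forall x y, (f x \subset f y) || (f y \subset f x)} ->
  exists2 x, x \in R & {in R, forall y, f y \subset f x}.
Proof.
move=> x0R nest; case: (@arg_maxnP _ x0 (mem R) (fun x => #|f x|) x0R) => x xR xmax.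
exists x => // y yR; have /orP[sub|//] := nest x y xR yR.
by have /eqP-> : f x == f y by rewrite eqEcard sub; apply: xmax.
Qed.

Lemma nested_min (T U : finType) (R : {set T}) (f : T -> {set U}) x0 :
  x0 \in R -> {in R &, forall x y, (f x \subset f y) || (f y \subset f x)} ->
  exists2 x, x \in R & {in R, forall y, f x \subset f y}.
Proof.
move=> x0R nest; case: (@arg_minnP _ x0 (mem R) (fun x => #|f x|) x0R) => x xR xmin.
exists x => // y yR; have /orP[//|sub] := nest x y xR yR.
by have /eqP<- : f y == f x by rewrite eqEcard sub; apply: xmin.
Qed.

Lemma not_nested (U : finType) (A B : {set U}) :
  ~~ ((A \subset B) || (B \subset A)) ->
  exists x y, [/\ x \in A, x \notin B, y \in B & y \notin A].
Proof.
by rewrite negb_or => /andP[/subsetPn[x xA xB] /subsetPn[y yB yA]]; exists x, y.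
Qed.

(* The traces on [I] of an independent [J] in [nbhd r] are nested. Fewer than
   [l] vertices of [J] have a trace of size at least [l], since they share the
   smallest of these traces. The others together see fewer than [l] vertices
   of [I], so exchanging them into [I] shows that there are fewer than [l]. *)
Lemma max_independent_nbhd (l : nat) (G : sgraph) (I J : {set G}) r :
  free (path_graph 5) G -> free (complete_bipartite l l) G ->
  independent I -> (forall S : {set G}, independent S -> #|S| <= #|I|) ->
  r \in I -> independent J -> J \subset nbhd r -> #|J| <= 2 * l.
Proof.
move=> freeP freeK indI maxI rI indJ /subsetP Jr.
have I0 := independentP _ indI; have J0 := independentP _ indJ.
pose t j := nbhd j :&: I.
have nested : {in J &, forall x y, (t x \subset t y) || (t y \subset t x)}.
  move=> x y xJ yJ; apply: contraT => /not_nested[u [w]].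
  rewrite !inE => -[/andP[xu uI] + /andP[yw wI]].
  rewrite uI wI !andbT => yu xw; exfalso; move: freeP.
  have := Jr x xJ; have := Jr y yJ; rewrite !inE => ry rx.
  apply: (@path_P5 _ u x r y w) => //; try exact: I0; try exact: J0.
  - by rewrite adj_sym.
  - by rewrite adj_sym.
  - by rewrite adj_sym.
pose Jh := [set j in J | l <= #|t j|]; pose Jl := J :\: Jh.
have JhJ : Jh \subset J by apply/subsetP=> x; rewrite inE => /andP[].
have JlJ : Jl \subset J by apply: subsetDl.
have cardJh : #|Jh| <= l.
  rewrite leqNgt; apply/negP => ltl; have /card_gt0P[x0 x0J] : 0 < #|Jh| by case: #|Jh| ltl.
  have [x xJ xmin] := nested_min x0J (sub_in2 (subsetP JhJ) nested).
  apply: biclique_not_free freeK => [||||u v uJ vt].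
  - exact: independentS JhJ indJ.
  - by apply: independentS indI; apply: subsetIr (nbhd x) _.
  - exact: ltnW.
  - by move: xJ; rewrite inE => /andP[].
  - by have /subsetP/(_ _ vt) := xmin u uJ; rewrite !inE => /andP[].
have cardJl : #|Jl| <= l.
  have [->|[x0 x0J]] := set_0Vmem Jl; first by rewrite cards0.
  have [x xJ xmax] := nested_max x0J (sub_in2 (subsetP JlJ) nested).
  have tl : #|t x| <= l.
    by move: xJ; rewrite !inE negb_and => /andP[/orP[/negPf->//|]]; rewrite -ltnNge => /ltnW.
  (* Since [t x] contains all traces of [Jl], the set [Jl :|: (I :\: t x)] is independent; comparing
     it with [I] gives [#|Jl| <= #|t x|]. *)
  apply: leq_trans tl; rewrite -(leq_add2r #|I :\: t x|).
  rewrite -cardsUI [X in _ <= X]addnC.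
  have -> : #|I :\: t x| + #|t x| = #|I|.
    by rewrite addnC -(cardsID (t x) I) (setIidPr _) // subsetIr.
  have -> : #|Jl :&: (I :\: t x)| = 0.
    apply/eqP; rewrite cards_eq0; apply/eqP/setP => z; rewrite in_setI in_set0.
    apply/negP => /andP[/(subsetP JlJ)/Jr]; rewrite !inE => rz /andP[_ zI].
    by have := I0 r z rI zI; rewrite rz.
  rewrite addn0; apply: maxI; apply/independentP.
  have cross u v : u \in Jl -> v \in I :\: t x -> ~~ adj u v.
    move=> uJ /setDP[vI]; apply: contra => uv.
    by apply: (subsetP (xmax u uJ)); rewrite inE in_nbhd uv.
  move=> u v /setUP[uJ|uI] /setUP[vJ|vI].
  - by apply: J0; apply: (subsetP JlJ).
  - exact: cross.
  - by rewrite adj_sym; apply: cross.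
  - by move: uI vI => /setDP[uI _] /setDP[vI _]; apply: I0.
rewrite -(cardsID Jh J) mul2n -addnn leq_add // (setIidPr _) //.
Qed.

(** * Independent sets in a bag *)

(** For [z] outside [S], this is the component of [G - S] containing [z], and [boundary S z] is the
    part of [S] attached to it. For [z] in [S] it degenerates to the singleton of [z]. *)
Definition component (G : sgraph) (S : {set G}) z : {set G} :=
  [set y | connect (restr (~: S)) z y].

Definition boundary (G : sgraph) (S : {set G}) z : {set G} :=
  [set w in S | [exists d in component S z, adj d w]].

Lemma component_refl (G : sgraph) (S : {set G}) z : z \in component S z.
Proof. by rewrite inE connect0. Qed.


Lemma restr_csym (G : sgraph) (S : {set G}) : connect_sym (restr S).
Proof. by apply: sym_connect_sym; apply: restr_sym. Qed.

Lemma component_eq (G : sgraph) (S : {set G}) y z : y \in component S z -> component S y = component S z.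
Proof.
rewrite inE => zy; apply/setP=> x; rewrite !inE.
by rewrite (same_connect (@restr_csym G (~: S)) zy).
Qed.

Lemma boundary_eq (G : sgraph) (S : {set G}) y z : y \in component S z -> boundary S y = boundary S z.
Proof. by move=> yz; rewrite /boundary (component_eq yz). Qed.

Lemma component_notin (G : sgraph) (S : {set G}) y z : z \notin S -> y \in component S z -> y \notin S.
Proof.
move=> zS; rewrite inE => /connectP[p zp ->]; elim/last_ind: p zp => [//|p x _].
by rewrite rcons_path last_rcons => /andP[_ /and3P[_ _]]; rewrite inE.
Qed.

Lemma component_adj (G : sgraph) (S : {set G}) x y z :
  z \notin S -> y \in component S z -> adj y x -> x \in component S z :|: boundary S z.
Proof.
move=> zS yz yx; have yS := component_notin zS yz.
rewrite in_setU [x \in boundary _ _]inE; case: (boolP (x \in S)) => xS /=.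
  by apply/orP; right; apply/exists_inP; exists y.
rewrite orbF inE; move: yz; rewrite inE => /connect_trans; apply.
by apply: connect1; rewrite /restr yx !inE yS.
Qed.

Lemma component_connect (G : sgraph) (S : {set G}) z x y :
  x \in component S z -> y \in component S z -> connect (restr (component S z)) x y.
Proof.
move=> xz yz; have : connect (restr (~: S)) x y.
  by move: yz; rewrite -(component_eq xz) inE.
case/connectP=> p xp ->; elim: p x xz xp {y yz} => [|y p IHp] x xz //=.
case/andP=> xy yp; have yz : y \in component S z.
  by move: xz; rewrite !inE => /connect_trans; apply; apply: connect1.
apply: connect_trans (IHp y yz yp); apply: connect1.
by case/and3P: xy => xy _ _; rewrite /restr xy xz.
Qed.

Lemma boundary_connect (G : sgraph) (S Y : {set G}) z u v :
  u \in boundary S z -> v \in boundary S z -> u \in Y -> v \in Y -> component S z \subset Y ->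
  connect (restr Y) u v.
Proof.
rewrite !inE => /andP[_ /exists_inP[d dz du]] /andP[_ /exists_inP[e ez ev]] uY vY zY.
have [dY eY] := (subsetP zY d dz, subsetP zY e ez).
apply: (@connect_trans _ _ d); first by apply: connect1; rewrite /restr adj_sym du uY.
apply: (@connect_trans _ _ e); last by apply: connect1; rewrite /restr ev eY.
exact: restr_connect_sub zY (component_connect dz ez).
Qed.

(** The largest of finitely many nested traces is their union, so one vertex of a nonempty [R] sees
    all that [R] sees in [J]. *)
Lemma nested_traces_cover (G : sgraph) (R J : {set G}) (k : nat) :
  {in R &, forall r r', (nbhd r :&: J \subset nbhd r' :&: J)
                     || (nbhd r' :&: J \subset nbhd r :&: J)} ->
  (forall r, r \in R -> #|nbhd r :&: J| <= k) ->
  #|[set j in J | [exists r in R, adj r j]]| <= k.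
Proof.
move=> nested bnd; have [R0|[r0 r0R]] := set_0Vmem R.
  rewrite (_ : [set _ in _ | _] = set0) ?cards0 //; apply/setP=> j; rewrite !inE.
  by apply/negP => /andP[_ /exists_inP[r]]; rewrite R0 inE.
have [r rR rmax] := nested_max r0R nested.
apply: leq_trans (bnd r rR); apply/subset_leq_card/subsetP => j.
rewrite inE => /andP[jJ /exists_inP[r' r'R rj]].
by apply: (subsetP (rmax r' r'R)); rewrite !inE rj.
Qed.

(** Here [S] stands for a maximal clique of a minimal completion: [link] will come from the
    minimality of the completion, [nofull] from the maximality of the clique. The 1 in the bound
    covers the case where [J] has at most one vertex. *)
Lemma bag_bound (G : sgraph) (I S : {set G}) (k : nat) :
  free (path_graph 5) G -> independent I ->
  (forall x, x \notin I -> exists2 r, r \in I & adj r x) ->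
  (forall r (J : {set G}), r \in I -> independent J -> J \subset nbhd r -> #|J| <= k) ->
  [disjoint I & S] ->
  {in S &, forall u v, u != v -> ~~ adj u v ->
     exists z, [/\ z \notin S, u \in boundary S z & v \in boundary S z]} ->
  (forall z, z \notin S -> exists2 w, w \in S & w \notin boundary S z) ->
  forall J : {set G}, J \subset S -> independent J -> #|J| <= maxn 1 (k + k).
Proof.
move=> freeP indI domI bndI dIS link nofull J JS indJ.
have I0 := independentP _ indI; have J0 := independentP _ indJ.
have sJ := subsetP JS.
have notIS r : r \in I -> r \notin S by move=> rI; rewrite (disjointFr dIS).
rewrite leq_max; case: leqP => //= /card_gt1P[x [y [xJ yJ nexy]]].
have boundS z u : u \in boundary S z -> u \in S by rewrite inE => /andP[].
(* Boundaries of two components that meet in [J] have nested traces on [J]. *)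
have [z zS Jz] : exists2 z, z \notin S & J \subset boundary S z.
  have [z0 [z0S xz0 yz0]] := link x y (sJ x xJ) (sJ y yJ) nexy (J0 x y xJ yJ).
  pose P := [set z | (z \notin S) && (1 < #|boundary S z :&: J|)].
  have z0P : z0 \in P.
    rewrite inE z0S; apply/card_gt1P; exists x, y.
    by rewrite in_setI xz0 xJ in_setI yz0 yJ.
  have [z zP zmax] := @arg_maxnP _ z0 (mem P) (fun z => #|boundary S z :&: J|) z0P.
  have /andP[zS z_gt1] : (z \notin S) && (1 < #|boundary S z :&: J|).
    by have : z \in P := zP; rewrite inE.
  (* If the largest trace misses [u], some [z'] links [u] to a vertex [t] of that trace; by
     maximality the trace of [z'] misses some [s] of the first one. *)
  exists z => //; apply/subsetP => u uJ; apply: contraT => uz; exfalso.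
  have /card_gt0P[t] : 0 < #|boundary S z :&: J| by apply: ltnW.
  rewrite in_setI => /andP[tz tJ].
  have netu : t != u by apply: contraNneq uz => <-.
  have [z' [z'S tz' uz']] := link t u (sJ t tJ) (sJ u uJ) netu (J0 t u tJ uJ).
  have z'P : z' \in P.
    by rewrite inE z'S; apply/card_gt1P; exists t, u; rewrite in_setI tz' tJ in_setI uz' uJ.
  have /subsetPn[s] : ~~ (boundary S z :&: J \subset boundary S z' :&: J).
    apply/negP => sub; have := zmax z' z'P; rewrite /= leqNgt => /negP; apply.
    apply: proper_card; apply/properP; split => //; exists u; rewrite in_setI.
      by rewrite uz' uJ.
    by rewrite (negPf uz).
  rewrite in_setI => /andP[sz sJ']; rewrite in_setI sJ' andbT => sz'.
  have dis d : d \in component S z -> d \notin component S z'.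
    move=> dz; apply/negP => dz'; move: sz'.
    by rewrite -(boundary_eq dz') (boundary_eq dz) sz.
  (* Inside [Y], the neighbours of [s] lie in the first component and those of [u] in the second.
     These are disjoint with no edge between them, so [s] and [u], joined through [t], are at
     distance at least 4. *)
  pose Y := [set s; t; u] :|: (component S z :|: component S z').
  have sY a : a \in Y -> adj s a -> a \in component S z.
    rewrite !in_setU !in_set1 -!orbA => /or4P[/eqP->|/eqP->|/eqP->|/orP[//|az']] sa.
    - by rewrite adj_irrefl in sa.
    - by have := J0 s t sJ' tJ; rewrite sa.
    - by have := J0 s u sJ' uJ; rewrite sa.
    - case/negP: sz'; rewrite inE sJ //=; apply/exists_inP; exists a => //.
      by rewrite adj_sym.
  have uY a : a \in Y -> adj a u -> a \in component S z'.
    rewrite !in_setU !in_set1 -!orbA => /or4P[/eqP->|/eqP->|/eqP->|/orP[az|//]] au.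
    - by have := J0 s u sJ' uJ; rewrite au.
    - by have := J0 t u tJ uJ; rewrite au.
    - by rewrite adj_irrefl in au.
    - by case/negP: uz; rewrite inE sJ //=; apply/exists_inP; exists a.
  have cross a b : a \in component S z -> b \in component S z' -> ~~ adj a b.
    move=> az bz'; apply/negP => ab; have := component_adj zS az ab.
    case/setUP=> [/dis|/boundS]; first by rewrite bz'.
    by rewrite (negPf (component_notin z'S bz')).
  apply: (@far_not_P5_free _ Y s u) freeP.
  - apply: (@connect_trans _ _ t).
      by apply: (boundary_connect sz tz); rewrite ?inE ?eqxx ?orbT // /Y setUC -setUA subsetUl.
    by apply: (boundary_connect tz' uz'); rewrite ?inE ?eqxx ?orbT // /Y setUA subsetUr.
  - by apply: contraNneq uz => <-.
  - exact: J0.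
  - by move=> a aY sa; apply/negP => au; move: (dis a (sY a aY sa)); rewrite uY.
  - move=> a b aY bY sa ab; apply/negP => bu.
    by have := cross a b (sY a aY sa) (uY b bY bu); rewrite ab.
have nbhd_bnd r : r \in I -> #|nbhd r :&: J| <= k.
  move=> rI; apply: (bndI r) => //; last exact: subsetIl.
  by apply: independentS indJ; apply: subsetIr.
have [w wS wz] := nofull z zS.
(* If the traces of [r] and [r'] are not nested, private neighbours [j] and [j'] joined through [Q]
   give a P5, because neither [r] nor [r'] sees [Q]. *)
have traces (R Q : {set G}) : R \subset I ->
    (forall r c, r \in R -> c \in Q -> ~~ adj r c) ->
    {in J &, forall j j', connect (restr (j |: (j' |: Q))) j j'} ->
    #|[set j in J | [exists r in R, adj r j]]| <= k.
  move=> /subsetP RI RQ conQ.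
  apply: nested_traces_cover => [r r' rR r'R|r /RI]; last exact: nbhd_bnd.
  apply: contraT => /not_nested[j [j']]; rewrite !in_setI !in_nbhd.
  case=> /andP[rj jJ]; rewrite jJ andbT => nr'j /andP[r'j' j'J].
  rewrite j'J andbT => nrj'; exfalso.
  apply: (@pendants_not_P5_free _ Q r j j' r') freeP => //; try by rewrite adj_sym.
  - by apply: I0; apply: RI.
  - exact: J0.
  - by move=> c cQ; split; [exact: RQ | rewrite adj_sym; exact: RQ].
  - exact: conQ.
pose D := component S z.
have inner : #|[set j in J | [exists r in I :&: D, adj r j]]| <= k.
  apply: (traces _ (~: (D :|: boundary S z))); first exact: subsetIl.
    move=> r c /setIP[_ rD]; rewrite inE.
    by apply: contra => /(component_adj zS rD).
  move=> j j' jJ j'J; set Y := _ |: _.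
  (* The vertex [w] is a hub: each vertex of [J] is adjacent to [w] or shares with it the boundary
     of a component, which is not [D] because [w] is not in the boundary of [D]. *)
  have wY : w \in Y.
    rewrite !in_setU1 in_setC in_setU negb_or wz andbT; apply/or3P/Or33.
    by apply/negP => /(component_notin zS); rewrite wS.
  have toW i : i \in J -> i \in Y -> connect (restr Y) i w.
    move=> iJ iY; have iz := subsetP Jz i iJ.
    have neiw : i != w by apply: contraNneq wz => <-.
    have [iw|niw] := boolP (adj i w); first by apply: connect1; rewrite /restr iw iY.
    have [z' [z'S iz' wz']] := link i w (sJ i iJ) wS neiw niw.
    apply: (boundary_connect iz' wz') => //; apply/subsetP=> c cz'.
    rewrite !in_setU1 in_setC in_setU negb_or; apply/or3P/Or33/andP; split.
      by apply: contra wz => cz; rewrite -(boundary_eq cz) (boundary_eq cz').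
    by apply: contra (component_notin z'S cz') => /boundS.
  apply: (@connect_trans _ _ w); first by apply: toW; rewrite // !inE eqxx.
  by rewrite restr_csym; apply: toW; rewrite // !inE eqxx orbT.
have outer : #|[set j in J | [exists r in I :\: D, adj r j]]| <= k.
  apply: (traces _ D); first exact: subsetDl.
    (* A vertex outside [D] with a neighbour in [D] belongs to [S], hence not to [I]. *)
    move=> r c /setDP[rI rD] cD; apply: contra rD; rewrite adj_sym => cr.
    have /setUP[//|/boundS] := component_adj zS cD cr.
    by rewrite (negPf (notIS r rI)).
  move=> j j' jJ j'J; apply: (boundary_connect (subsetP Jz j jJ) (subsetP Jz j' j'J)).
  - by rewrite !inE eqxx.
  - by rewrite !inE eqxx orbT.
  - by rewrite setUA subsetUr.
apply: leq_trans (leq_add inner outer).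
apply: leq_trans (leq_card_setU _ _); apply/subset_leq_card/subsetP => j jJ.
have [r rI rj] : exists2 r, r \in I & adj r j.
  by apply: domI; apply: contraTN (sJ j jJ) => /notIS.
rewrite in_setU !in_set jJ /=; have [rD|rD] := boolP (r \in D); apply/orP; [left|right];
  by apply/exists_inP; exists r; rewrite // ?in_setI ?in_setD rI rD.
Qed.

(** * Chordal relations and clique trees *)

(** Relations are finite sets of ordered pairs, so that their size can be minimized. As [setX K K]
    contains the diagonal, a clique carries all its loops. *)
Definition clique (T : finType) (H : {set T * T}) (K : {set T}) : bool :=
  setX K K \subset H.

Lemma cliqueP (T : finType) (H : {set T * T}) (K : {set T}) :
  reflect {in K &, forall x y, (x, y) \in H} (clique H K).
Proof.
apply: (iffP subsetP) => [KH x y xK yK|KH [x y] /setXP[xK yK]]; last exact: KH.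
by apply: KH; rewrite in_setX xK.
Qed.

Lemma cliqueS (T : finType) (H : {set T * T}) (K L : {set T}) :
  K \subset L -> clique H L -> clique H K.
Proof.
by move=> KL; apply: subset_trans; apply/subsetP=> -[x y] /setXP[xK yK];
   rewrite in_setX !(subsetP KL).
Qed.

Definition no_edges (T : finType) (H : {set T * T}) (A B : {set T}) : Prop :=
  forall x y, x \in A -> y \in B -> (x, y) \notin H /\ (y, x) \notin H.

(* By Dirac's theorem this characterizes the vertex sets on which [H] induces a
   chordal graph. *)
Inductive chordal (T : finType) (H : {set T * T}) : {set T} -> Prop :=
| chordal_clique X of clique H X : chordal H X
| chordal_glue X1 X2 of chordal H X1 & chordal H X2 & clique H (X1 :&: X2)
    & no_edges H (X1 :\: X2) (X2 :\: X1) : chordal H (X1 :|: X2).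

(** Intersect both sides of every gluing with [Y]. Agreement of [H'] with [H] is asked on [Y] only,
    so that [H'] may drop pairs elsewhere. *)
Lemma chordal_sub (T : finType) (H H' : {set T * T}) (X Y : {set T}) :
  chordal H X -> Y \subset X ->
  {in Y &, forall x y, ((x, y) \in H') = ((x, y) \in H)} -> chordal H' Y.
Proof.
move=> HX; elim: HX Y => {X} [X XH|X1 X2 _ IH1 _ IH2 MH noE] Y YX HH'.
  apply: chordal_clique; apply/cliqueP => x y xY yY; rewrite HH' //.
  by apply: (cliqueP _ _ XH); apply: (subsetP YX).
have -> : Y = (Y :&: X1) :|: (Y :&: X2) by rewrite -setIUr; apply/esym/setIidPl.
have sub Z : {in Y :&: Z &, forall x y, ((x, y) \in H') = ((x, y) \in H)}.
  by move=> x y /setIP[xY _] /setIP[yY _]; apply: HH'.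
apply: chordal_glue.
- by apply: IH1 => //; apply: subsetIr.
- by apply: IH2 => //; apply: subsetIr.
- apply/cliqueP => x y; rewrite -setIIr => /setIP[xY xM] /setIP[yY yM].
  by rewrite HH' //; apply: (cliqueP _ _ MH).
- move=> x y; rewrite !inE => /andP[x2 /andP[xY x1]] /andP[y1 /andP[yY y2]].
  rewrite xY /= in x2; rewrite yY /= in y1.
  by rewrite !HH' //; apply: noE; rewrite !inE ?x1 ?x2 ?y1 ?y2.
Qed.

Lemma clique_glue (T : finType) (H : {set T * T}) (X1 X2 K : {set T}) :
  no_edges H (X1 :\: X2) (X2 :\: X1) -> clique H K -> K \subset X1 :|: X2 ->
  (K \subset X1) || (K \subset X2).
Proof.
move=> noE /cliqueP KH /subsetP KX; apply: contraT; rewrite negb_or.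
case/andP=> /subsetPn[y yK y1] /subsetPn[x xK x2].
have [||+ _] := noE x y; last by rewrite KH.
- by have := KX x xK; rewrite !inE (negPf x2) orbF.
- by have := KX y yK; rewrite !inE (negPf y1).
Qed.

Lemma no_edgesC (T : finType) (H : {set T * T}) (A B : {set T}) :
  no_edges H A B -> no_edges H B A.
Proof. by move=> noE x y xB yA; have [] := noE y x yA xB. Qed.

(** With each vertex, [Q] contains everything reachable from it by [H] in [X :\: S], and it is not
    attached to all of [S]. Such closed sets extend along a gluing more easily than single
    components. *)
Definition separated (T : finType) (H : {set T * T}) (X S Q : {set T}) : Prop :=
  [/\ Q \subset X :\: S,
      (forall q y, q \in Q -> y \in X -> y \notin S -> (q, y) \in H -> y \in Q) &
      exists2 w, w \in S & forall q, q \in Q -> (q, w) \notin H].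

Lemma separated_glue (T : finType) (H : {set T * T}) (X1 X2 S Q : {set T}) :
  clique H (X1 :&: X2) -> no_edges H (X1 :\: X2) (X2 :\: X1) -> S \subset X1 ->
  separated H X1 S Q ->
  separated H (X1 :|: X2) S (if [disjoint Q & X2] then Q else Q :|: (X2 :\: X1)).
Proof.
move=> /cliqueP MH noE /subsetP SX [/subsetP QX Qcl [w wS Qw]].
have Q1 q : q \in Q -> q \in X1 by case/QX/setDP.
have Q0 q : q \in Q -> q \notin S by case/QX/setDP.
case: ifP => [dQ|/negbT/pred0Pn[c /andP[/= cQ c2]]].
  split; last by exists w.
    by apply/subsetP=> q qQ; rewrite !inE Q0 ?Q1.
  move=> q y qQ /setUP[y1|y2] yS qy; first exact: Qcl qy.
  have [y1|y1] := boolP (y \in X1); first exact: Qcl qy.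
  have [||] := noE q y; rewrite ?qy // !inE ?y1 ?y2 //.
  by rewrite (disjointFr dQ qQ) Q1.
have c1 := Q1 c cQ.
(* A pair from [X2 :\: X1] back to [X1] ends in the overlap, a clique containing [c]. Whatever the
   added vertices reach in [X1] is thus already reached from [c], which lies in [Q]. *)
have toc q y : q \in X2 :\: X1 -> y \in X1 -> (q, y) \in H -> (c, y) \in H.
  move=> q2 y1 qy; have y2 : y \in X2.
    apply: contraT => y2; have [||] := noE y q; rewrite ?qy //.
    by rewrite !inE y1 y2.
  by apply: MH; rewrite !inE ?c1 ?y1.
split.
- apply/subsetP=> q /setUP[qQ|/setDP[q2 q1]]; first by rewrite !inE Q0 ?Q1.
  by rewrite !inE q2 orbT andbT; apply: contra q1 => /SX.
- move=> q y qQ yX yS qy; rewrite !inE.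
  have [y1|y1] := boolP (y \in X1); last first.
    by move: yX; rewrite !inE (negPf y1) /= => ->; rewrite orbT.
  case/setUP: qQ => [qQ|qQ]; first by rewrite (Qcl q).
  by rewrite (Qcl c) ?(toc q).
- exists w => // q /setUP[/Qw//|qQ]; apply: contra (Qw c cQ).
  by apply: toc => //; apply: SX.
Qed.

(** Induction on the gluing: the clique [S] lies on one side, and a set found there extends to the
    union. In the base case [z |: S] would be a clique, against the maximality of [S]. *)
Lemma chordal_separated (T : finType) (H : {set T * T}) (X S : {set T}) z :
  chordal H X -> S \subset X -> clique H S ->
  (forall x, x \in X :\: S -> ~~ clique H (x |: S)) -> z \in X :\: S ->
  exists2 Q : {set T}, z \in Q & separated H X S Q.
Proof.
move=> HX; elim: HX z => {X} [X XH|X1 X2 _ IH1 _ IH2 MH noE] z SX SH maxS zX.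
  case/negP: (maxS z zX); apply: cliqueS XH; rewrite subUset SX sub1set.
  by case/setDP: zX => ->.
pose P (X : {set T}) := forall z, S \subset X -> clique H S ->
  (forall x, x \in X :\: S -> ~~ clique H (x |: S)) -> z \in X :\: S ->
  exists2 Q : {set T}, z \in Q & separated H X S Q.
have glue Y1 Y2 : P Y1 -> P Y2 -> clique H (Y1 :&: Y2) ->
    no_edges H (Y1 :\: Y2) (Y2 :\: Y1) ->
    (forall x, x \in (Y1 :|: Y2) :\: S -> ~~ clique H (x |: S)) ->
    z \in (Y1 :|: Y2) :\: S -> S \subset Y1 ->
    exists2 Q : {set T}, z \in Q & separated H (Y1 :|: Y2) S Q.
  move=> {IH1 IH2 MH noE SX maxS zX} {X1 X2} P1 P2 MH noE maxS /setDP[zY zS] S1.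
  have max1 x : x \in Y1 :\: S -> ~~ clique H (x |: S).
    by case/setDP=> x1 xS; apply: maxS; rewrite !inE x1 xS.
  have max2 x : x \in Y2 :\: S -> ~~ clique H (x |: S).
    by case/setDP=> x2 xS; apply: maxS; rewrite !inE x2 xS orbT.
  have [z1|z1] := boolP (z \in Y1).
    have [|Q zQ /(separated_glue MH noE S1)] := P1 z S1 SH max1; first by rewrite !inE z1 zS.
    by move=> sep; apply: (ex_intro2 _ _ _ _ sep); case: ifP => //; rewrite inE zQ.
  have z2 : z \in Y2 by move: zY; rewrite inE (negPf z1).
  (* Now [z] lies in [Y2] only. If the overlap has a vertex [c] outside [S], the set found for [c]
     in [Y1] absorbs [Y2 :\: Y1]. Otherwise either [S] is inside [Y2], and the sides are exchanged,
     or [Y2 :\: Y1] is itself closed and unattached to a vertex of [S] outside [Y2]. *)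
  have [/existsP[c /andP[/setIP[c1 c2] cS]]|/existsPn MS] :=
      boolP [exists c, (c \in Y1 :&: Y2) && (c \notin S)].
    have [|Q cQ /(separated_glue MH noE S1)] := P1 c S1 SH max1; first by rewrite !inE c1 cS.
    move=> sep; apply: (ex_intro2 _ _ _ _ sep); case: ifP => [dQ|_]; last by rewrite !inE z1 z2 orbT.
    by rewrite (disjointFr dQ cQ) in c2.
  have [S2|/subsetPn[w wS w2]] := boolP (S \subset Y2).
    rewrite setUC; rewrite setIC in MH; have noE' := no_edgesC noE.
    have [|Q zQ /(separated_glue MH noE' S2)] := P2 z S2 SH max2; first by rewrite !inE z2 zS.
    by move=> sep; apply: (ex_intro2 _ _ _ _ sep); case: ifP => //; rewrite inE zQ.
  exists (Y2 :\: Y1); first by rewrite !inE z1.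
  split.
  - apply/subsetP=> q /setDP[q2 q1]; rewrite !inE q2 orbT andbT.
    by apply: contra q1; apply: (subsetP S1).
  - move=> q y q2 /setUP[] yY yS qy; last first.
      rewrite !inE yY andbT; apply: contra (MS y); rewrite !inE yY => ->.
      by rewrite yS.
    have [||] := noE y q; rewrite ?qy // !inE yY andbT.
    by apply: contra (MS y); rewrite !inE yY => ->; rewrite yS.
  - exists w => // q q2; have [|_ //] := noE w q _ q2.
    by rewrite !inE w2 (subsetP S1).
have /orP[S1|S2] := clique_glue noE SH SX; first exact: (glue X1 X2).
rewrite setUC; apply: (glue X2 X1) => //; rewrite 1?setIC 1?setUC //.
exact: no_edgesC.
Qed.

(* [p i] is the parent of the node [i], for [0 < i < n]; the root is [0]. *)
Record clique_tree (T : finType) (H : {set T * T}) (X : {set T})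
    (n : nat) (p : nat -> nat) (b : nat -> {set T}) : Prop := CliqueTree {
  ct_parent : forall i, 0 < i < n -> p i < i;
  ct_bag : forall i, i < n -> (b i \subset X) && clique H (b i);
  ct_cover : forall K : {set T}, K \subset X -> clique H K ->
    exists2 i, i < n & K \subset b i;
  ct_connected : forall i j x, i < j < n -> x \in b i -> x \in b j -> x \in b (p j) }.

(** Prescribing a clique in the root bag makes the induction work: the second tree is rooted at a
    bag containing the overlap and hung below a bag of the first tree that contains it too. *)
Lemma chordal_clique_tree (T : finType) (H : {set T * T}) (X K : {set T}) :
  chordal H X -> K \subset X -> clique H K ->
  exists n p b, [/\ clique_tree H X n p b, 0 < n & K \subset b 0].
Proof.
move=> HX; elim: HX K => {X} [X XH|X1 X2 _ IH1 _ IH2 MH noE] K KX KH.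
  exists 1, id, (fun=> X); split=> //; split=> //.
  - by case.
  - by rewrite subxx.
  - by move=> L LX _; exists 0.
pose P (X : {set T}) := forall K : {set T}, K \subset X -> clique H K ->
  exists n p b, [/\ clique_tree H X n p b, 0 < n & K \subset b 0].
have glue Y1 Y2 : P Y1 -> P Y2 -> clique H (Y1 :&: Y2) ->
    no_edges H (Y1 :\: Y2) (Y2 :\: Y1) -> K \subset Y1 ->
    exists n p b, [/\ clique_tree H (Y1 :|: Y2) n p b, 0 < n & K \subset b 0].
  move=> {IH1 IH2 MH noE KX} {X1 X2} P1 P2 MH noE K1.
  have [n1 [p1 [b1 [[par1 bag1 cov1 con1] n1_gt0 Kb1]]]] := P1 K K1 KH.
  have [n2 [p2 [b2 [[par2 bag2 cov2 con2] n2_gt0 Mb2]]]] := P2 _ (subsetIr _ _) MH.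
  have [r rn1 Mr] := cov1 _ (subsetIl _ _) MH.
  (* The nodes of the second tree are shifted by [n1]; its root becomes node [n1], with parent
     [r]. *)
  exists (n1 + n2), (fun i => if i < n1 then p1 i else
                              if i == n1 then r else n1 + p2 (i - n1)),
    (fun i => if i < n1 then b1 i else b2 (i - n1)).
  split; [split|by rewrite addn_gt0 n1_gt0|by rewrite n1_gt0].
  - move=> i /andP[i_gt0 lti] /=; case: (ltnP i n1) => [lt1|le1]; first by rewrite par1 ?i_gt0.
    case: (eqVneq i n1) => [->//|nei]; have ltni : n1 < i by rewrite ltn_neqAle eq_sym nei.
    by rewrite -ltn_subRL par2 // subn_gt0 ltni ltn_subLR.
  - move=> i lti /=; case: (ltnP i n1) => [/bag1/andP[bX ->]|le1].
      by rewrite andbT (subset_trans bX) ?subsetUl.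
    have /bag2/andP[bX ->] : i - n1 < n2 by rewrite ltn_subLR.
    by rewrite andbT (subset_trans bX) ?subsetUr.
  - move=> L LX LH; have /orP[L1|L2] := clique_glue noE LH LX.
      by have [i lti Li] := cov1 L L1 LH; exists i; rewrite ?lti // ltn_addr.
    have [i lti Li] := cov2 L L2 LH; exists (n1 + i); first by rewrite ltn_add2l.
    by rewrite ltnNge leq_addr /= addKn.
  - move=> i j x /andP[ij ltj] /=; case: (ltnP j n1) => [j1|j1].
      have ltp : p1 j < n1 by apply: ltn_trans (j1); rewrite par1 // j1 (leq_ltn_trans _ ij).
      by rewrite (ltn_trans ij j1) ltp; apply: con1; rewrite ij.
    have ltj' : j - n1 < n2 by rewrite ltn_subLR.
    have xY k y : k < n1 -> y \in b1 k -> y \in Y1.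
      by move=> /bag1/andP[/subsetP bY _] /bY.
    have yY k y : k < n2 -> y \in b2 k -> y \in Y2.
      by move=> /bag2/andP[/subsetP bY _] /bY.
    case: (ltnP i n1) => i1 xi xj.
      (* A vertex occurring on both sides lies in the overlap, hence in the bag of [r] and in the
         root bag of the second tree. *)
      have xM : x \in Y1 :&: Y2 by rewrite inE (xY i) // (yY (j - n1)).
      case: (eqVneq j n1) => [_|nej]; first by rewrite rn1 (subsetP Mr).
      rewrite ltnNge leq_addr /= addKn; apply: (con2 0) => //.
        by rewrite subn_gt0 ltj' ltn_neqAle eq_sym nej j1.
      exact: (subsetP Mb2).
    have ltn1j : n1 < j by apply: leq_ltn_trans ij.
    rewrite gtn_eqF // ltnNge leq_addr /= addKn; apply: (con2 (i - n1)) => //.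
    by rewrite ltj' andbT ltn_sub2r.
have /orP[K1|K2] := clique_glue noE KH KX; first exact: (glue X1 X2).
rewrite setUC; apply: (glue X2 X1) => //; first by rewrite setIC.
exact: no_edgesC.
Qed.

(** * Trees given by a parent function *)

Lemma connected_descent (G : sgraph) (h : G -> nat) (r : G) :
  (forall x, x != r -> exists2 y, adj x y & h y < h x) -> connected G.
Proof.
move=> desc; have conr x : connect (@adj G) x r.
  have [m] := ubnP (h x); elim: m x => // m IHm x; rewrite ltnS => hx.
  have [->|/desc[y xy hy]] := eqVneq x r; first exact: connect0.
  by apply: connect_trans (connect1 xy) (IHm y _); apply: leq_trans hx.
move=> x y; apply: connect_trans (conr x) _.
by rewrite (sym_connect_sym (@adj_sym G)).
Qed.

Section ParentTree.
Variables (n : nat) (p : nat -> nat).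
Hypothesis n_gt0 : 0 < n.
Hypothesis p_lt : forall i, 0 < i < n -> p i < i.

(** The guards discard the value of [p] at the root 0, which is unconstrained. *)
Definition parent_adj : rel 'I_n := fun i j =>
  ((0 < j) && (p j == i)) || ((0 < i) && (p i == j)).

Lemma parent_adj_sym : symmetric parent_adj.
Proof. by move=> i j; rewrite /parent_adj orbC. Qed.

Lemma parent_adj_irrefl : irreflexive parent_adj.
Proof.
move=> i; rewrite /parent_adj orbb; apply/negbTE/negP => /andP[i_gt0 /eqP pi].
by have := @p_lt i; rewrite i_gt0 ltn_ord pi ltnn; apply/implyP.
Qed.

Definition parent_tree : sgraph := SGraph parent_adj_sym parent_adj_irrefl.

Lemma parent_adj_lt (i j : 'I_n) : parent_adj i j -> i < j -> p j = i.
Proof.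
move=> /orP[/andP[_ /eqP//]|/andP[i_gt0 /eqP pi]] ij.
have := @p_lt i; rewrite i_gt0 ltn_ord pi => /(_ isT).
by rewrite ltnNge ltnW.
Qed.

(** Following parents from any node of [S] stays in [S] and descends to its least node. *)
Lemma parent_tree_induced_connected (S : {set 'I_n}) :
  (forall i j : 'I_n, i \in S -> j \in S -> i < j ->
     exists2 k : 'I_n, k \in S & p j = k) ->
  connected (@induced parent_tree S).
Proof.
move=> par; have [S0|[i0 i0S]] := set_0Vmem S.
  by move=> [x xS]; exfalso; move: (xS); rewrite S0 inE.
have [r rS rmin] := @arg_minnP _ i0 (mem S) (fun i : 'I_n => i : nat) i0S.
apply: (@connected_descent (@induced parent_tree S) (fun x => (val x : 'I_n) : nat)
  (exist _ r rS)) => -[x xS] nexr.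
have rx : r < x.
  by rewrite ltn_neqAle rmin // andbT; apply: contraNneq nexr => /val_inj e; apply/eqP/val_inj.
have [k kS pk] := par r x rS xS rx.
have x_gt0 : 0 < x by apply: leq_ltn_trans rx.
exists (exist _ k kS).
  by rewrite /adj /= /induced_adj /adj /= /parent_adj x_gt0 pk eqxx orbT.
by rewrite /= -pk p_lt // x_gt0 /=.
Qed.

Lemma parent_tree_is_tree : is_tree parent_tree.
Proof.
split; first by rewrite card_ord.
- apply: (@connected_descent parent_tree (fun x => (x : 'I_n) : nat) (Ordinal n_gt0)) => x nex0.
  have x_gt0 : 0 < (x : 'I_n) by rewrite lt0n; apply: contraNneq nex0 => e; apply/eqP/val_inj.
  have ltpx : p (x : 'I_n) < (x : 'I_n) by rewrite p_lt // x_gt0 /=.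
  exists (Ordinal (ltn_trans ltpx (ltn_ord x))) => //.
  by rewrite /adj /= /parent_adj x_gt0 eqxx orbT.
- move=> c c_gt2 /andP[cyc uniq_c].
  have [m0 m0c] : exists m, m \in c.
    by case: c c_gt2 {cyc uniq_c} => // m c _; exists m; rewrite inE eqxx.
  (* Both neighbours on the cycle of its largest node are the parent of that node. *)
  have [m mc m_max] := @arg_maxnP _ m0 (mem c) (fun i : 'I_n => i : nat) m0c.
  have [k q rot_c] := rot_to mc.
  have : [/\ cycle parent_adj (m :: q), uniq (m :: q) & 2 < size (m :: q)].
    by rewrite -rot_c rot_cycle rot_uniq size_rot.
  have mq y : y \in q -> (y : 'I_n) <= (m : 'I_n).
    by move=> yq; apply: m_max; rewrite /= -(mem_rot k) rot_c inE yq orbT.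
  case: q {rot_c} mq => [_ []//|x q]; case/lastP: q => [_ []//|q y] mq [].
  rewrite /= rcons_path !last_rcons => /andP[mx /andP[_ ym]] /and3P[mq' xq _] _.
  have lt_m z : z \in x :: rcons q y -> (z : 'I_n) < (m : 'I_n).
    by move=> zq; rewrite ltn_neqAle mq // andbT; apply: contraNneq mq' => /val_inj <-.
  have y_in : y \in rcons q y by rewrite mem_rcons inE eqxx.
  have px : p m = x by apply: parent_adj_lt; rewrite ?lt_m ?inE ?eqxx // parent_adj_sym.
  have py : p m = y by apply: parent_adj_lt; rewrite ?lt_m ?inE ?y_in ?orbT.
  by case/negP: xq; rewrite (_ : x = y) //; apply: val_inj; rewrite /= -px.
Qed.
End ParentTree.

(** * Minimal chordal completions *)

Lemma chordal_tree_decomposition (G : sgraph) (H : {set G * G}) :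
  chordal H setT -> (forall x, (x, x) \in H) ->
  (forall x y : G, adj x y -> (x, y) \in H) ->
  exists D : tree_decomposition G, forall t : td_tree D, clique H (bag t).
Proof.
move=> HG Hxx Hadj.
have [||n [p [b [[par bagH cov con] n_gt0 _]]]] := @chordal_clique_tree _ _ _ set0 HG.
- exact: sub0set.
- by apply/cliqueP=> x y; rewrite inE.
have cover (K : {set G}) : clique H K -> exists t : 'I_n, K \subset b t.
  by case/(cov K (subsetT K)) => i lti; exists (Ordinal lti).
have cov1 v : exists t : parent_tree par, v \in b (t : 'I_n).
  have [|t] := cover [set v]; last by rewrite sub1set; exists t.
  by apply/cliqueP=> x y /set1P-> /set1P->.
have cov2 (u v : G) : adj u v ->
    exists t : parent_tree par, (u \in b (t : 'I_n)) && (v \in b (t : 'I_n)).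
  move=> uv; have [|t] := cover [set u; v].
    apply/cliqueP=> x y /set2P[]-> /set2P[]->; rewrite ?Hxx ?Hadj //.
    by rewrite adj_sym.
  by rewrite subUset !sub1set; exists t.
have conn v : connected (induced [set t : parent_tree par | v \in b (t : 'I_n)]).
  apply: parent_tree_induced_connected => // i j; rewrite !inE => vi vj ij.
  have ltpj : p j < j by rewrite par // ltn_ord andbT (leq_ltn_trans _ ij).
  exists (Ordinal (ltn_trans ltpj (ltn_ord j))) => //.
  by rewrite inE; apply: (con i); rewrite ?ij /=.
exists (TreeDecomposition (parent_tree_is_tree n_gt0 par) cov1 conn cov2) => t.
by have /andP[] := bagH _ (ltn_ord t).
Qed.

Lemma alpha_induced_leq (G : sgraph) (B : {set G}) (m : nat) :
  (forall J : {set G}, J \subset B -> independent J -> #|J| <= m) ->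
  alpha (induced B) <= m.
Proof.
move=> bnd; apply/bigmax_leqP => S /independentP S0.
rewrite -(card_imset _ val_inj); apply: bnd.
  by apply/subsetP=> _ /imsetP[x _ ->]; apply: valP.
by apply/independentP => _ _ /imsetP[x xS ->] /imsetP[y yS ->]; apply: S0.
Qed.

(* The relation [H] is reflexive; loops aside, it is a chordal supergraph of
   [G] in which the vertices of [I] are simplicial and have no new neighbours. *)
Record completion (G : sgraph) (I : {set G}) (H : {set G * G}) : Prop := Completion {
  compl_chordal : chordal H setT;
  compl_refl : forall x, (x, x) \in H;
  compl_adj : forall x y : G, adj x y -> (x, y) \in H;
  compl_nbhd : forall r, r \in I -> clique H (r |: nbhd r);
  compl_nbhd_sub : forall r x, r \in I -> (r, x) \in H -> x \in r |: nbhd r }.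

(** Take all pairs outside [I] together with all pairs inside a closed neighbourhood of a vertex of
    [I]. *)
Lemma completion_exists (G : sgraph) (I : {set G}) :
  independent I -> exists H, completion I H.
Proof.
move=> /independentP I0.
pose H := [set e : G * G | [|| (e.1 \notin I) && (e.2 \notin I) |
  [exists r in I, (e.1 \in r |: nbhd r) && (e.2 \in r |: nbhd r)]]].
have HN r x y : r \in I -> x \in r |: nbhd r -> y \in r |: nbhd r -> (x, y) \in H.
  by move=> rI xr yr; rewrite inE; apply/orP; right; apply/exists_inP; exists r; rewrite // xr.
have HW x y : x \notin I -> y \notin I -> (x, y) \in H by rewrite inE /= => -> ->.
have NI r x : r \in I -> x \in I -> x \in r |: nbhd r -> x = r.
  move=> rI xI; rewrite !inE => /orP[/eqP//|rx].
  by have := I0 r x rI xI; rewrite rx.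
have Hr r x : r \in I -> (r, x) \in H \/ (x, r) \in H -> x \in r |: nbhd r.
  move=> rI xH; suff [s sI [rs xs]] : exists2 s, s \in I & r \in s |: nbhd s /\ x \in s |: nbhd s.
    by rewrite (NI s r sI rI rs).
  by case: xH; rewrite inE /= rI ?andbF /= => /exists_inP[s sI /andP[]]; exists s.
exists H; split.
(* Starting from the clique [~: I], the closed neighbourhoods of the vertices of [I] are glued on
   one at a time. *)
- have chordal_part (A : {set G}) : A \subset I -> chordal H (~: I :|: A).
    have [m] := ubnP #|A|; elim: m A => // m IHm A; rewrite ltnS => Am AI.
    have [->|[r rA]] := set_0Vmem A.
      rewrite setU0; apply: chordal_clique; apply/cliqueP=> x y; rewrite !in_setC.
      by move=> xI yI; apply: HW.
    have rI := subsetP AI r rA.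
    have NrI x : x \in r |: nbhd r -> (x == r) || (x \in ~: I).
      by move=> xr; rewrite inE orbC -implybE; apply/implyP => xI; apply/eqP/(NI r).
    have -> : ~: I :|: A = (~: I :|: (A :\ r)) :|: (r |: nbhd r).
      apply/setP=> x; have [->|nexr] := eqVneq x r; first by rewrite !inE rA eqxx !orbT.
      rewrite !inE (negPf nexr) /=; case: (boolP (x \in I)) => //= xI.
      by rewrite (negPf (I0 r x rI xI)) orbF.
    apply: chordal_glue.
    + apply: IHm; last by apply: subset_trans AI; apply: subsetDl.
      by apply: leq_trans Am; rewrite [X in _ < X](cardsD1 r) rA.
    + by apply: chordal_clique; apply/cliqueP=> x y; apply: HN.
    + by apply/cliqueP=> x y /setIP[_ xr] /setIP[_ yr]; apply: (HN r).
    + move=> x y /setDP[_ xr] /setDP[yr ynot].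
      have yr' : y = r.
        apply/eqP; have /orP[//|yI] := NrI y yr.
        by rewrite in_setU yI in ynot.
      by split; apply: contra xr; rewrite yr' => xH; apply: Hr; [|right|..]; auto.
  have <- : ~: I :|: I = setT by rewrite setUC setUCr.
  exact: chordal_part.
- move=> x; have [xI|xI] := boolP (x \in I); last exact: HW.
  by apply: (HN x); rewrite // !inE eqxx.
- move=> x y xy; have [xI|xI] := boolP (x \in I).
    by apply: (HN x); rewrite // !inE ?eqxx ?xy ?orbT.
  have [yI|yI] := boolP (y \in I); last exact: HW.
  by apply: (HN y); rewrite // !inE ?eqxx // adj_sym xy orbT.
- by move=> r rI; apply/cliqueP=> x y; apply: HN.
- by move=> r x rI rx; apply: Hr => //; left.
Qed.

(* The smaller completion keeps the edges of [H] inside [X1], which is [S :\ v]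
   with the components not attached to [v], and inside [X2], which is [S :\ u]
   with the other ones; the edge [uv] is lost. *)
Lemma completion_split (G : sgraph) (I S : {set G}) (H : {set G * G}) u v :
  completion I H -> clique H S -> [disjoint I & S] ->
  u \in S -> v \in S -> u != v -> ~~ adj u v ->
  (forall z, z \notin S -> ~ (u \in boundary S z /\ v \in boundary S z)) ->
  exists2 H', completion I H' & #|H'| < #|H|.
Proof.
move=> [HG Hxx Hadj HN HNsub] /cliqueP SH dIS uS vS neuv nuv nolink.
pose X1 := [set x | if x \in S then x != v else v \notin boundary S x].
pose X2 := [set x | if x \in S then x != u else v \in boundary S x].
pose H' := H :&: (setX X1 X1 :|: setX X2 X2).
have HX1 : {in X1 &, forall x y, ((x, y) \in H') = ((x, y) \in H)}.
  by move=> x y x1 y1; rewrite in_setI in_setU !in_setX x1 y1 /= andbT.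
have HX2 : {in X2 &, forall x y, ((x, y) \in H') = ((x, y) \in H)}.
  by move=> x y x2 y2; rewrite in_setI in_setU !in_setX x2 y2 /= orbT andbT.
have boundS z x : x \in boundary S z -> x \in S by rewrite inE => /andP[].
(* By [nolink], the boundary of a component misses [u] or [v], so a component and its boundary lie
   on one side. Hence edges of [G] with an end outside [S] survive. *)
have part z : z \notin S ->
    (component S z :|: boundary S z \subset X1) || (component S z :|: boundary S z \subset X2).
  move=> zS; have [vz|vz] := boolP (v \in boundary S z); apply/orP; [right|left].
    apply/subsetP=> x /setUP[xz|xz]; rewrite inE.
      by rewrite (negPf (component_notin zS xz)) (boundary_eq xz).
    rewrite (boundS _ _ xz); apply/eqP => xu; apply: (nolink z zS).
    by rewrite -xu.
  apply/subsetP=> x /setUP[xz|xz]; rewrite inE.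
    by rewrite (negPf (component_notin zS xz)) (boundary_eq xz).
  by rewrite (boundS _ _ xz); apply: contraNneq vz => <-.
have keep z x y : z \notin S -> x \in component S z :|: boundary S z ->
    y \in component S z :|: boundary S z -> (x, y) \in H -> (x, y) \in H'.
  by move=> /part/orP[]/subsetP sub /sub xX /sub yX; [rewrite HX1 | rewrite HX2].
exists H'; last first.
  apply: proper_card; rewrite properE subsetIl; apply/subsetPn; exists (u, v); first exact: SH.
  by rewrite in_setI in_setU !in_setX !inE /= uS vS !eqxx andbF /= andbF.
have X12 : X1 :|: X2 = setT.
  apply/setP=> x; rewrite !inE; case: ifP => _; last by rewrite orNb.
  by case: (eqVneq x v) => //= ->; rewrite eq_sym.
have nbhd_part r : r \in I -> r |: nbhd r \subset component S r :|: boundary S r.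
  move=> rI; apply/subsetP=> x; have rS : r \notin S by rewrite (disjointFr dIS).
  rewrite in_setU1 in_nbhd => /orP[/eqP->|]; first by rewrite inE component_refl.
  by apply: component_adj => //; apply: component_refl.
have adj_part x y : x \notin S -> adj x y -> (y \in component S x :|: boundary S x).
  by move=> xS; apply: component_adj => //; apply: component_refl.
have self_part x : x \in component S x :|: boundary S x by rewrite in_setU component_refl.
split.
- rewrite -X12; apply: chordal_glue.
  + by apply: chordal_sub HG _ HX1; apply: subsetT.
  + by apply: chordal_sub HG _ HX2; apply: subsetT.
  + apply/cliqueP=> x y /setIP[x1 x2] /setIP[y1 y2]; rewrite HX1 //.
    have inS z : z \in X1 -> z \in X2 -> z \in S.
      by rewrite !inE; case: ifP => // _ /negPf->.
    by apply: SH; apply: inS.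
  + move=> x y /setDP[x1 x2] /setDP[y2 y1].
    by rewrite !in_setI !in_setU !in_setX (negPf x2) (negPf y1) !andbF.
- move=> x; have : x \in X1 :|: X2 by rewrite X12.
  by case/setUP=> xX; [rewrite HX1 | rewrite HX2].
- move=> x y xy; have xyH := Hadj x y xy.
  have [xS|xS] := boolP (x \in S); last by apply: (keep x) => //; apply: adj_part.
  have [yS|yS] := boolP (y \in S); last by apply: (keep y) => //; apply: adj_part; rewrite // adj_sym.
  (* An edge of [G] inside [S] can leave [X1] only by having [v] as an end; its other end is not
     [u], so it lies in [X2]. *)
  have [x1|] := boolP (x \in X1).
    have [y1|] := boolP (y \in X1); first by rewrite HX1.
    rewrite inE yS negbK => /eqP ev; rewrite HX2 // inE ?xS ?yS; last by rewrite ev eq_sym.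
    by apply: contraNneq nuv => <-; rewrite -ev.
  rewrite inE xS negbK => /eqP ev; rewrite HX2 // inE ?xS ?yS; first by rewrite ev eq_sym.
  by apply: contraNneq nuv => <-; rewrite -ev adj_sym.
- move=> r rI; apply/cliqueP=> x y xr yr.
  apply: (keep r); first by rewrite (disjointFr dIS).
  + exact: (subsetP (nbhd_part r rI)).
  + exact: (subsetP (nbhd_part r rI)).
  + by apply: (cliqueP _ _ (HN r rI)).
- by move=> r x rI /setIP[+ _]; apply: HNsub.
Qed.

(** Edges of [G] belong to [H], so a closed set [Q] containing [z] contains its component in
    [G - S]; a vertex of [S] to which [Q] is not attached is then off the boundary. *)
Lemma completion_no_full (G : sgraph) (I S : {set G}) (H : {set G * G}) z :
  completion I H -> maxset (clique H) S -> z \notin S ->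
  exists2 w, w \in S & w \notin boundary S z.
Proof.
move=> [HG _ Hadj _ _] /maxsetP[SH maxS] zS.
have [||Q zQ [/subsetP QS Qcl [w wS Qw]]] :=
    chordal_separated (z := z) HG (subsetT S) SH.
- move=> x /setDP[_ xS]; apply: contra xS => /maxS <-; first exact: setU11.
  exact: subsetU1.
- by rewrite !inE zS.
exists w => //; rewrite inE wS /=; apply/exists_inP => -[d dz dw].
suff dQ : d \in Q by have := Qw d dQ; rewrite Hadj.
move: dz; rewrite inE => /connectP[p zp ->]; elim: p z zS zQ zp => //= y p IHp z zS zQ.
case/andP=> /and3P[zy _]; rewrite inE => yS yp.
by apply: (IHp y) => //; apply: (Qcl z) => //; apply: Hadj.
Qed.

Theorem theorem1p4 (l : nat) (l_gt0 : 0 < l) (G : sgraph)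
    (P5_free : free (path_graph 5) G)
    (Kll_free : free (complete_bipartite l l) G) :
  tree_alpha G <= 4 * l.
Proof.
have ind0 : independent (set0 : {set G}) by apply/independentP => x y; rewrite inE.
have [I indI maxI] := @arg_maxnP _ set0 (fun S : {set G} => independent S) (fun S => #|S|) ind0.
have I0 := independentP _ indI.
have domI x : x \notin I -> exists2 r, r \in I & adj r x.
  move=> xI; apply/exists_inP; apply: contraT; rewrite negb_exists_in => /forall_inP nrx.
  have : #|x |: I| <= #|I|.
    apply: maxI; apply/independentP => y y' /setU1P[->|yI] /setU1P[->|y'I].
    - by rewrite adj_irrefl.
    - by rewrite adj_sym nrx.
    - exact: nrx.
    - exact: I0.
  by rewrite cardsU1 xI ltnn.
have bndI r (J : {set G}) : r \in I -> independent J -> J \subset nbhd r -> #|J| <= 2 * l.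
  exact: max_independent_nbhd.
have [H HI minH] : exists2 H, completion I H & forall H', completion I H' -> #|H| <= #|H'|.
  have [H0 H0I] := completion_exists indI.
  (* Descent on the number of pairs, with excluded middle deciding whether a smaller completion
     exists. *)
  have [m] := ubnP #|H0|; elim: m H0 H0I => // m IHm H0 H0I; rewrite ltnS => Hm.
  have [[H' H'I lt']|no] := boolp.EM (exists2 H', completion I H' & #|H'| < #|H0|).
    by apply: (IHm H') => //; apply: leq_trans Hm.
  by exists H0 => // H' H'I; rewrite leqNgt; apply/negP => lt'; apply: no; exists H'.
have clique_bound (K J : {set G}) : clique H K -> J \subset K -> independent J -> #|J| <= 4 * l.
  (* Bags are cliques but perhaps not maximal, while the lemmas on completions concern maximal
     ones. *)
  move=> /maxset_exists[S maxS KS] JK indJ; have JS := subset_trans JK KS.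
  have SH := maxsetp maxS.
  have [dIS|/pred0Pn[r /andP[/= rI rS]]] := boolP [disjoint I & S].
    have -> : 4 * l = maxn 1 (2 * l + 2 * l).
      by rewrite -mulnDl (maxn_idPr _) // muln_gt0.
    apply: (@bag_bound G I S) => //; last by move=> z zS; apply: completion_no_full HI maxS zS.
    move=> u v uS vS neuv nuv; apply: boolp.contrapT => nolink.
    have [|H' H'I] := completion_split HI SH dIS uS vS neuv nuv.
      by move=> z zS [uz vz]; apply: nolink; exists z.
    by rewrite ltnNge minH.
  (* Now [S] contains some [r] of [I], which has no new neighbours, so [S] lies in its closed
     neighbourhood. An independent [J] is then just [r] or avoids [r]. *)
  have Sr x : x \in S -> x \in r |: nbhd r.
    by move=> xS; apply: (compl_nbhd_sub HI rI); apply: (cliqueP _ _ SH).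
  have [rJ|rJ] := boolP (r \in J).
    apply: leq_trans (_ : 1 <= _); last by rewrite muln_gt0.
    rewrite -(cards1 r); apply/subset_leq_card/subsetP => x xJ.
    have := Sr x (subsetP JS x xJ); rewrite in_setU1 in_nbhd in_set1.
    by rewrite (negPf (independentP _ indJ r x rJ xJ)) orbF.
  apply: leq_trans (bndI r J rI indJ _) _; last by rewrite leq_mul2r orbT.
  apply/subsetP=> x xJ; have := Sr x (subsetP JS x xJ).
  by rewrite in_setU1; case: eqVneq => // xr; rewrite -xr xJ in rJ.
have [D DH] := chordal_tree_decomposition (compl_chordal HI) (compl_refl HI) (compl_adj HI).
rewrite /tree_alpha; case: ex_minnP => m _ /(_ (td_alpha D)) minm.
apply: leq_trans (minm _) _; first by apply/boolp.asboolP; exists D.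
apply/bigmax_leqP => t _; apply: alpha_induced_leq => J JB indJ.
exact: clique_bound (DH t) JB indJ.
Qed.
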